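(* Let $t\ge 1$ be an integer. Every graph $G$ with $\operatorname{zig}(G)=\chi(G)=t$ contains the complete graph $K_{\lfloor t/2\rfloor+1}$ as a totally odd immersion.
   Context: All graphs are finite, undirected and loopless; $\chi(G)$ is the chromatic number of $G$. Write $[t]=\{1,\dots,t\}$. Let $c$ be a proper colouring of a graph $G$, with colours taken to be positive integers. A zigzag in $(G,c)$ is a sequence of vertices $z_1,z_2,\dots,z_t$ of $G$ such that (i) $c(z_i)<c(z_{i+1})$ for all $1\le i<t$, and (ii) for each even $i\in[t]$, the vertex $z_i$ is adjacent to all vertices $z_j$ with $j\in[t]$ odd. The size of the zigzag is $t$. The zigzag number of $(G,c)$, denoted $\operatorname{zig}(G,c)$, is the size of a maximum zigzag of $(G,c)$. The zigzag number of $G$, denoted $\operatorname{zig}(G)$, is the minimum of $\operatorname{zig}(G,c)$ over all proper colourings $c$ of $G$ (with any number of colours). A graph $G$ contains a graph $H$ as a totally odd immersion if there are an injection $\varphi\colon V(H)\to V(G)$ and, for every edge $uv\in E(H)$, a path $P_{uv}$ in $G$ with endpoints $\varphi(u)$ and $\varphi(v)$ and of odd length (number of edges), such that the paths $P_{uv}$ ($uv\in E(H)$) are pairwise edge-disjoint and no vertex of $\varphi(V(H))$ (these vertices are called terminals) is an internal vertex of any of these paths. *)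

(* Defs.v *)
From mathcomp Require Import all_boot.
From mathcomp Require Import boolp.
Set Implicit Arguments.
Unset Strict Implicit.
Unset Printing Implicit Defensive.

Record sgraph := SGraph {
  vertex :> finType;
  adj : rel vertex;
  adj_sym : symmetric adj;
  adj_irrefl : irreflexive adj }.

Arguments adj {s} x y.

Definition edges (G : sgraph) : {set {set G}} :=
  [set [set a.1; a.2] | a : G * G & adj a.1 a.2].

Lemma complete_sym n : symmetric [rel i j : 'I_n | i != j].
Proof. by move=> i j /=; rewrite eq_sym. Qed.

Lemma complete_irrefl n : irreflexive [rel i j : 'I_n | i != j].
Proof. by move=> i /=; rewrite eqxx. Qed.

Definition complete (n : nat) : sgraph :=
  SGraph (@complete_sym n) (@complete_irrefl n).

Section Colouring.
Variable G : sgraph.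

Definition proper_colouring (C : eqType) (c : G -> C) : bool :=
  [forall x, forall y, adj x y ==> (c x != c y)].

Definition colourable (k : nat) : bool :=
  [exists c : {ffun G -> 'I_k}, proper_colouring c].

Lemma colourable_ex : exists k, colourable k.
Proof.
exists #|G|; apply/existsP; exists (finfun enum_rank).
apply/'forall_forallP => x y; apply/implyP => xy.
by apply: contraTneq xy; rewrite !ffunE => /enum_rank_inj ->; rewrite adj_irrefl.
Qed.

Definition chi : nat := ex_minn colourable_ex.

Definition pos_proper_colouring (c : G -> nat) : bool :=
  [forall v, 0 < c v] && proper_colouring c.

(* Indices are 0-based: an even position of z_1, ..., z_t is an odd index. *)
Definition zigzag (c : G -> nat) (t : nat) (z : t.-tuple G) : bool :=
  sorted [rel x y | c x < c y] z &&
  [forall i : 'I_t, forall j : 'I_t,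
     odd i && ~~ odd j ==> adj (tnth z i) (tnth z j)].

Definition has_zigzag (c : G -> nat) (t : nat) : bool :=
  [exists z : t.-tuple G, zigzag c z].

Lemma has_zigzag_ex c : exists t, has_zigzag c t.
Proof.
exists 0; apply/existsP; exists [tuple]; rewrite /zigzag /=.
by apply/forallP => -[].
Qed.

Lemma has_zigzag_bound c t : has_zigzag c t -> t <= #|G|.
Proof.
case/existsP => z /andP[zs _]; rewrite -(size_tuple z) -(card_uniqP _) ?max_card //.
apply: sorted_uniq zs => [y x w /=|x /=]; [exact: ltn_trans | exact: ltnn].
Qed.

Definition zig_col (c : G -> nat) : nat :=
  ex_maxn (has_zigzag_ex c) (@has_zigzag_bound c).

Lemma zig_ex :
  exists k, `[< exists2 c : G -> nat, pos_proper_colouring c & zig_col c = k >].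
Proof.
exists (zig_col (fun v => (enum_rank v).+1)); apply/asboolP.
exists (fun v => (enum_rank v).+1) => //; apply/andP; split; first exact/forallP.
apply/'forall_forallP => x y; apply/implyP => xy.
apply: contraTneq xy => -[] /val_inj /enum_rank_inj ->.
by rewrite adj_irrefl.
Qed.

Definition zig : nat := ex_minn zig_ex.

End Colouring.

(* A path is the sequence of all its vertices, both ends included. *)
Definition path_between (G : sgraph) (x y : G) (p : seq G) : bool :=
  if p is a :: q then
    [&& a == x, last a q == y, path adj a q & uniq p]
  else false.

Definition path_length (T : Type) (p : seq T) : nat := (size p).-1.

Definition path_edges (G : sgraph) (p : seq G) : seq {set G} :=
  [seq [set a.1; a.2] | a <- zip p (behead p)].

Definition internal (T : Type) (p : seq T) : seq T :=
  if p is a :: q then behead (belast a q) else [::].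

(* The paths are indexed by the unordered edges of H, hence the two possible
   directions in which the vertex sequence of a path may be listed. *)
Definition totally_odd_immersion (H G : sgraph)
    (phi : H -> G) (P : {set H} -> seq G) : Prop :=
  [/\ injective phi,
      forall u v : H, adj u v ->
        let p := P [set u; v] in
        (path_between (phi u) (phi v) p || path_between (phi v) (phi u) p)
        && odd (path_length p),
      forall e f : {set H}, e \in edges H -> f \in edges H -> e != f ->
        ~~ has (mem (path_edges (P e))) (path_edges (P f)) &
      forall (e : {set H}) (w : H), e \in edges H ->
        phi w \notin internal (P e)].

Definition has_totally_odd_immersion (G H : sgraph) : Prop :=
  exists (phi : H -> G) (P : {set H} -> seq G), totally_odd_immersion phi P.

(* Main.v *)
Require Import Defs.
From mathcomp Require Import all_boot.
From mathcomp Require Import boolp.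
Set Implicit Arguments.
Unset Strict Implicit.
Unset Printing Implicit Defensive.

(** Colour G with t colours and pair the colours up: group i, for i < s = t/2,
    is the union of the colour classes 2i and 2i+1. Choose the colouring so that
    as few edges as possible have both ends in one group. For distinct groups i
    and j let H be the bipartite graph of the edges of G between group i and
    group j. Exchanging the colours 2i+b and 2j+b (b = 0, 1) on one component
    of H gives a proper colouring again; it turns every edge that joins that
    component to the rest of its own group into an edge between groups, and
    creates no new edge inside a group. By minimality no such edge exists: the
    ends of an edge inside group i lie in one component of H
    ([connect_inner_edge]). This is a Kempe change on pairs of colours, and the
    reason for pairing the colours is that a path of H from group i to group j
    automatically has odd length.

    As zig(G) = t, the colouring has a zigzag with exactly one vertex of each
    colour ([rainbow_zigzag]). Let v i b be its vertex of colour 2i+b; then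
    v i b is adjacent to v j (~~ b) for all i and j, also when i = j. By the
    above the four vertices of groups i and j are in one component of H, so
    picking one vertex in each group gives s terminals that are joined by
    edge-disjoint odd paths. One more terminal is needed, and one group r, the
    root, has to supply both of its vertices.

    Say that i doubles j if, for some b, the graph H contains a path from v i b
    to v j b that misses v i (~~ b). If i = r then this path and the edge from
    v r (~~ b) to v j b join both root vertices to the terminal v j b. If i does
    not double j, then H has a path from v i 0 to v i 1 that misses both v j 0
    and v j 1 ([detour]), whence j doubles i ([doubles_total]). So doubling is
    total, like the relation of a tournament, and a group r doubling as many
    groups as possible is a king ([exists_king]): every j not doubled by r has a
    parent k, doubled by r, such that j does not double k. The detour of j in
    the edges between groups j and k then serves the second root vertex: that
    vertex goes along an edge to the vertex of group j that is not a terminal,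
    and along the detour to the terminal of group j. To leave the rest of these
    edges to the pair j, k, the terminals of j and k are chosen with different
    b, so that a single edge, which the detour cannot use, joins them
    ([rooted_routes]).

    Disjointness is obtained by construction: every edge of G gets an owner, a
    pair of terminals, and each pair is joined inside the edges that it owns.
    These edges form a bipartite graph with the two terminals on opposite sides,
    so that any path between them has odd length ([immersion_of_regions]). *)

(** * Paths avoiding a set *)

Definition avoid (T : finType) (e : rel T) (S : {set T}) : rel T :=
  [rel x y | [&& e x y, x \notin S & y \notin S]].

Lemma avoid_sym (T : finType) (e : rel T) (S : {set T}) :
  symmetric e -> symmetric (avoid e S).
Proof. by move=> se x y; rewrite /avoid /= se [(x \notin S) && _]andbC. Qed.

Lemma path_avoid (T : finType) (e : rel T) (S : {set T}) x p :
  path e x p -> {in x :: p, forall z, z \notin S} -> path (avoid e S) x p.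
Proof.
move=> exp xpS; apply: (@sub_in_path _ [in x :: p] e) (exp); last exact/allP.
by move=> y z yp zp eyz; rewrite /avoid /= eyz !xpS.
Qed.

(** A simple path from x to y that meets S at w splits at w into a part that
    misses its end y and a part that misses its start x. *)
Lemma connect_through (T : finType) (e : rel T) (S : {set T}) x y :
    x \notin S -> y \notin S -> connect e x y ->
  connect (avoid e S) x y \/
  exists2 w, w \in S &
    connect (avoid e [set y]) x w /\ connect (avoid e [set x]) w y.
Proof.
move=> xS yS /connectP[p0 ep0 y_p0]; rewrite y_p0 in yS *.
move: yS; case/shortenP: ep0 => p ep up _ yS.
have [/hasP[w wp wS]|/hasPn pS] := boolP (has [in S] p); last first.
  left; apply/connectP; exists p => //; apply: path_avoid => // z.
  by rewrite inE => /predU1P[->//|]; apply: pS.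
right; exists w => //; move: ep up yS; case/splitPr: p / wp => p1 p2.
rewrite cat_path last_cat /= => /and3P[ep1 lw ep2] /andP[xp].
rewrite cat_uniq /= => /and3P[_ p12 /andP[wp2 _]] yS.
have y_p2 : last w p2 \in p2.
  by case: p2 {ep2 xp p12 wp2} yS => [|a p2] /=; rewrite ?wS ?mem_last.
split; apply/connectP.
  exists (rcons p1 w); last by rewrite last_rcons.
  apply: path_avoid => [|z]; first by rewrite rcons_path ep1.
  rewrite !inE mem_rcons inE; apply: contraL => /eqP ->.
  move: xp p12; rewrite mem_cat inE !negb_or => /and3P[_ _ xp2].
  case/andP=> _ /hasPn/(_ _ y_p2) /= yp1.
  by rewrite yp1 (memPn xp2) // (memPn wp2).
exists p2 => //; apply: path_avoid => // z zp; rewrite inE.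
by apply: contraNneq xp => <-; rewrite mem_cat zp orbT.
Qed.

(** * Totally odd immersions from edge ownership *)

Section Regions.
Variables (G : sgraph) (n : nat) (phi : 'I_n -> G) (own : G -> G -> {set G}).

(** The edges that the terminal pair W may use. Those touching a third terminal
    are left out, so a path in a region has no terminal inside. *)
Definition region (W : {set G}) : rel G :=
  [rel x y | [&& adj x y, own x y == W,
                 (x \in codom phi) ==> (x \in W) &
                 (y \in codom phi) ==> (y \in W)]].

Hypothesis phi_inj : injective phi.
Hypothesis own_sym : forall x y, own x y = own y x.

Lemma path_edges_rel (e : rel G) x p (S : {set G}) :
  path e x p -> S \in path_edges (x :: p) ->
  exists y z, S = [set y; z] /\ e y z.
Proof.
rewrite /path_edges /=; elim: p x => //= y p IHp x /andP[exy ep].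
rewrite inE => /predU1P[->|]; first by exists x, y.
exact: IHp.
Qed.

Lemma internalP (x : G) p z : uniq (x :: p) -> z \in internal (x :: p) ->
  [/\ z \in p, z != x & z != last x p].
Proof.
case: p => // y p; rewrite cons_uniq [last x _]/= [internal _]/= lastI.
move=> /andP[xp up] zp.
rewrite mem_rcons inE zp orbT; split=> //.
  by apply: contraNneq xp => <-; rewrite mem_rcons inE zp orbT.
by move: up; rewrite rcons_uniq => /andP[+ _]; apply: contraNneq => <-.
Qed.

(** Each step changes sides, so the ends determine the parity of the length. *)
Lemma odd_size_path (T : eqType) (e : rel T) (side : T -> bool) x p :
  (forall y z, e y z -> side y != side z) -> path e x p ->
  odd (size p) = side x (+) side (last x p).
Proof.
move=> flip; elim: p x => [|y p IHp] x /=; first by rewrite addbb.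
by case/andP=> /flip xy /IHp ->; move: xy; do 3!case: (side _).
Qed.

(** Reduces a totally odd immersion to connectivity: since an edge has a single
    owner, regions of different pairs are edge-disjoint, and in a bipartite
    region that separates the two terminals into opposite sides every path
    between them is odd. *)
Lemma immersion_of_regions :
  (forall u v, u != v ->
     let W := [set phi u; phi v] in
     connect (region W) (phi u) (phi v) /\
     exists2 side : G -> bool,
       forall x y, region W x y -> side x != side y &
       side (phi u) != side (phi v)) ->
  has_totally_odd_immersion G (complete n).
Proof.
move=> regP.
pose good (e : {set 'I_n}) p := exists u v, [/\ u != v, e = [set u; v],
  path_between (phi u) (phi v) p, odd (path_length p) &
  exists2 q, p = phi u :: q & path (region (phi @: e)) (phi u) q].
have /choice[P Pgood] : forall e : {set complete n}, exists p,
    e \in edges (complete n) -> good e p.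
  move=> e; have [/imsetP[[u v] uv ->]|] := boolP (e \in edges _); last first.
    by exists [::].
  have {uv} uv : u != v by move: uv; rewrite inE.
  have [/connectP[p0 rp0 vp0] [side flip uv_side]] := regP u v uv.
  rewrite /= in vp0; move: vp0 uv_side; case/shortenP: rp0 => q rq uq _.
  move=> vq uv_side.
  exists (phi u :: q) => _; exists u, v; split=> //.
  - rewrite /path_between eqxx -vq eqxx uq andbT.
    by apply: sub_path rq => x y /and4P[].
  - rewrite /path_length /= (odd_size_path flip rq) -vq.
    by move: uv_side; do 2!case: (side _).
  by exists q => //; rewrite imsetU1 imset_set1.
(* The three remaining clauses: odd paths, disjointness, no terminal inside. *)
exists phi, P; split=> //.
- move=> u v uv; have euv : [set u; v] \in edges (complete n).
    by apply/imsetP; exists (u, v); rewrite ?inE.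
  have [u' [v' [u'v' e_uv pb op _]]] := Pgood _ euv.
  apply/andP; split; last exact: op.
  have: u' \in [set u; v] by rewrite e_uv set21.
  have: v' \in [set u; v] by rewrite e_uv set22.
  move: u'v' pb; rewrite !inE => u'v' pb.
  by do 2!case/pred2P=> ?; subst u' v'; rewrite ?pb ?orbT // eqxx in u'v' *.
- move=> e f /Pgood[u [v [_ _ _ _ [p -> rp]]]].
  move=> /Pgood[u' [v' [_ _ _ _ [q -> rq]]]].
  apply: contraNN => /hasP[S /(path_edges_rel rq)[x' [y' [-> ]]]].
  move=> /and4P[_ /eqP oe _ _].
  move=> /(path_edges_rel rp)[x [y [Sxy /and4P[_ /eqP of' _ _]]]].
  have {oe of'} : phi @: e = phi @: f.
    rewrite -oe -of'; have: x' \in [set x; y] by rewrite -Sxy set21.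
    have: y' \in [set x; y] by rewrite -Sxy set22.
    have: x \in [set x'; y'] by rewrite Sxy set21.
    have: y \in [set x'; y'] by rewrite Sxy set22.
    by rewrite !inE; do 4!case/pred2P=> ?; subst; rewrite // own_sym.
  by move/(imset_inj phi_inj) => ->.
move=> e w /Pgood[u [v [_ e_uv pb _ [q Pe rq]]]]; rewrite Pe in pb *.
apply/negP; case/and4P: pb => _ /eqP lq _ uq.
move=> /(internalP uq)[wq /eqP wu /eqP]; rewrite lq => wv.
have: phi w \in phi @: e.
  have: all (fun x => (x \in codom phi) ==> (x \in phi @: e)) q.
    elim: q (phi u) rq {wq lq uq Pe wu} => //= x q IHq y.
    case/andP=> /and4P[_ _ _ ->]; exact: IHq.
  by move/allP/(_ _ wq); rewrite codom_f.
case/imsetP=> w' + /phi_inj ww'.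
by rewrite -ww' e_uv !inE => /pred2P[]/(congr1 phi).
Qed.

End Regions.

(** * Groups and the choice of the root *)

Section Routing.
Variables (G : sgraph) (s : nat) (grp : G -> option 'I_s).
Variable v : 'I_s -> bool -> G.

(** The bipartite graph H of two groups, as a relation on all vertices. *)
Definition between (i j : 'I_s) : rel G :=
  [rel x y | adj x y &&
     ((grp x == Some i) && (grp y == Some j)
      || (grp x == Some j) && (grp y == Some i))].

Lemma between_sym i j : symmetric (between i j).
Proof.
move=> x y; rewrite /between /= adj_sym orbC.
by rewrite [(grp y == _) && _]andbC [in X in _ || X]andbC.
Qed.

Lemma betweenC i j : between i j =2 between j i.
Proof. by move=> x y; rewrite /between /= orbC. Qed.

Definition both j : {set G} := [set v j false; v j true].

Hypothesis grp_v : forall i b, grp (v i b) = Some i.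
Hypothesis adj_v : forall i j b, adj (v i b) (v j (~~ b)).

Lemma between_v i j b : between i j (v i b) (v j (~~ b)).
Proof. by rewrite /between /= adj_v !grp_v !eqxx. Qed.

Section Doubling.
Hypothesis connect_inner : forall i j x y, i != j ->
  adj x y -> grp x = Some i -> grp y = Some i -> connect (between i j) x y.

(** The four zigzag vertices of two groups span only the two edges
    v i b -- v j (~~ b) of the bipartite graph; the edges v i 0 -- v i 1 inside
    the groups tie these together because they stay within one component. *)
Lemma connect_v i j b b' : i != j -> connect (between i j) (v i b) (v j b').
Proof.
move=> ij; have step c : connect (between i j) (v i c) (v j (~~ c)).
  exact/connect1/between_v.
have [<-|b'b] := eqVneq (~~ b) b'; first exact: step.
have {b'b} -> : b' = b by case: b b' b'b => [] [].
apply: (@connect_trans _ _ (v i (~~ b))); last first.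
  by have := step (~~ b); rewrite negbK.
by apply: connect_inner; rewrite ?adj_v ?grp_v.
Qed.

(** Both vertices of group i can be joined to the same vertex v j b by
    edge-disjoint odd paths: v i (~~ b) by an edge, v i b by a path that
    avoids v i (~~ b). *)
Definition doubles i j :=
  [exists b, connect (avoid (between i j) [set v i (~~ b)]) (v i b) (v j b)].

Lemma v_neq i j b b' : i != j -> v i b != v j b'.
Proof. by apply: contraNneq => /(congr1 grp); rewrite !grp_v => -[->]. Qed.

Lemma v_inj i b b' : (v i b == v i b') = (b == b').
Proof.
apply/eqP/eqP=> [vb|-> //]; have := adj_v i i b; case: b b' vb => [] [] //= ->.
all: by rewrite adj_irrefl.
Qed.

(** A simple path between the two vertices of group i cannot meet v j c: one of
    its two parts would show that i doubles j, the first part if c = b and the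
    second one if c = ~~ b. *)
Lemma detour i j b : i != j -> ~~ doubles i j ->
  connect (avoid (between i j) (both j)) (v i b) (v i (~~ b)).
Proof.
move=> ij /existsPn nd; have conn : connect (between i j) (v i b) (v i (~~ b)).
  by apply: connect_inner; rewrite ?adj_v ?grp_v.
have notin c : v i c \notin (both j).
  by rewrite !inE !(negPf (v_neq _ _ ij)).
case: (connect_through (notin b) (notin (~~ b)) conn) => // -[w wS [c1 c2]].
have [c w_c] : exists c, w = v j c.
  by case/set2P: wS => ->; [exists false | exists true].
subst w; have [cb|cb] := eqVneq c b; first by subst c; case/negP: (nd b).
have {}cb : c = ~~ b by case: b c cb {wS nd conn notin c1 c2} => [] [].
subst c; case/negP: (nd (~~ b)); rewrite negbK sym_connect_sym //.
exact/avoid_sym/between_sym.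
Qed.

(** The detour of i, entered from v j 1 by the edge to v i 0, ends at v i 1
    without using v j 0. *)
Lemma doubles_total i j : i != j -> ~~ doubles i j -> doubles j i.
Proof.
move=> ij nd; apply/existsP; exists true.
have sub : subrel (avoid (between i j) (both j))
                  (avoid (between j i) [set v j false]).
  move=> x y /and3P[]; rewrite betweenC /avoid /= !inE => -> /norP[/negPf -> _].
  by case/norP=> /negPf ->.
apply: (@connect_trans _ _ (v i false)); last first.
  by apply: (connect_sub _ (detour false ij nd)) => x y /sub/connect1.
by apply: connect1; rewrite /avoid /= between_v /= !inE v_inj v_neq.
Qed.

(** The classical argument for kings in tournaments: if j were to double all
    groups that a group r of maximum out-degree doubles, then j, which also
    doubles r, would have a larger out-degree. *)
Lemma exists_king (i0 : 'I_s) : exists r, forall j, j != r ->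
  ~~ doubles r j -> exists k, [/\ k != r, k != j, doubles r k & ~~ doubles j k].
Proof.
pose out i := [set k | (k != i) && doubles i k].
case: (@arg_maxnP _ i0 predT (fun i => #|out i|)) => // r _ r_max.
exists r => j jr nd.
have [k /and4P[*]|no_k] :=
  pickP [pred k | [&& k != r, k != j, doubles r k & ~~ doubles j k]].
  by exists k.
have r_out_j : r \in out j by rewrite inE eq_sym jr doubles_total // eq_sym.
suff /proper_card : out r \proper out j.
  by rewrite ltnNge => /negP[]; exact: r_max.
apply/properP; split; last by exists r; rewrite // inE eqxx.
apply/subsetP=> k; rewrite !inE => /andP[kr rk].
have kj : k != j by apply: contraNneq nd => <-.
by have /negbT := no_k k; rewrite /= kr kj rk negbK.
Qed.

(** All that the construction of the paths needs. The terminal of group j is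
    v j (beta j), and for the root it is v r false, next to the additional
    terminal v r true. [direct j] says that r doubles j; then beta j has to be
    the side on which it does. Otherwise beta j is free, and is chosen opposite
    to that of the parent so that the two terminals are adjacent. *)
Lemma rooted_routes (i0 : 'I_s) :
  exists r, exists parent : 'I_s -> 'I_s, exists direct : pred 'I_s,
  exists beta : 'I_s -> bool,
  [/\ beta r = false,
      forall j, j != r -> direct j ->
        connect (avoid (between r j) [set v r (~~ beta j)])
          (v r (beta j)) (v j (beta j)) &
      forall j, j != r -> ~~ direct j ->
        [/\ parent j != r, parent j != j, direct (parent j),
            beta j = ~~ beta (parent j) &
            connect (avoid (between j (parent j)) (both (parent j)))
              (v j (~~ beta j)) (v j (beta j))]].
Proof.
have [r king] := exists_king i0.
have /choice[parent parentP] : forall j, exists k, j != r -> ~~ doubles r j ->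
    [/\ k != r, k != j, doubles r k & ~~ doubles j k].
  move=> j; case: (boolP ((j != r) && ~~ doubles r j)) => [/andP[jr nd]|nn].
    by have [k ?] := king j jr nd; exists k.
  by exists j => jr nd; rewrite jr nd in nn.
have /choice[b0 b0P] : forall j, exists b, doubles r j ->
    connect (avoid (between r j) [set v r (~~ b)]) (v r b) (v j b).
  move=> j; case: (boolP (doubles r j)) => [/existsP[b ?]|_]; first by exists b.
  by exists false.
pose beta j := if j == r then false else
  if doubles r j then b0 j else ~~ b0 (parent j).
exists r, parent, (doubles r), beta; split=> [|j jr dj|j jr nd].
- by rewrite /beta eqxx.
- by rewrite /beta (negPf jr) dj; apply: b0P.
have [fr fj dr df] := parentP j jr nd; split=> //.
  by rewrite /beta (negPf jr) (negPf nd) (negPf fr) dr.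
by rewrite -{2}[beta j]negbK; apply: detour; rewrite // eq_sym.
Qed.

End Doubling.

(** * Owners of the edges *)

Section Assembly.
Variables (r : 'I_s) (parent : 'I_s -> 'I_s) (direct : pred 'I_s).
Variable beta : 'I_s -> bool.
Hypothesis beta_r : beta r = false.
Hypothesis direct_route : forall j, j != r -> direct j ->
  connect (avoid (between r j) [set v r (~~ beta j)])
    (v r (beta j)) (v j (beta j)).
Hypothesis parent_route : forall j, j != r -> ~~ direct j ->
  [/\ parent j != r, parent j != j, direct (parent j),
            beta j = ~~ beta (parent j) &
      connect (avoid (between j (parent j)) (both (parent j)))
        (v j (~~ beta j)) (v j (beta j))].

Definition terminal (u : 'I_s.+1) : G :=
  if unlift ord0 u is Some j then v j (beta j) else v r true.

Let rep j := v j (beta j).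

Lemma terminal_inj : injective terminal.
Proof.
move=> u u'; rewrite /terminal.
case: unliftP => [j|] ->; case: unliftP => [j'|] -> //.
- by move/(congr1 grp); rewrite !grp_v => -[->].
- move=> e; have [jr] : Some j = Some r.
    by rewrite -(grp_v j (beta j)) e grp_v.
  by move/eqP: e; rewrite jr v_inj beta_r.
- move=> e; have [jr] : Some j' = Some r.
    by rewrite -(grp_v j' (beta j')) -e grp_v.
  by move/eqP: e; rewrite -jr v_inj jr beta_r.
Qed.

Lemma terminalP x :
  reflect ((exists j, x = rep j) \/ x = v r true) (x \in codom terminal).
Proof.
apply: (iffP codomP) => [[u ->]|[[j ->]|->]].
- by rewrite /terminal; case: unliftP => [j|] _; [left; exists j | right].
- by exists (lift ord0 j); rewrite /terminal liftK.
- by exists ord0; rewrite /terminal unlift_none.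
Qed.

Definition child j k := [&& j != r, ~~ direct j & parent j == k].
(** The only pair at group j that may need more than an edge: the terminal of j
    is adjacent to v r (~~ beta j). *)
Definition root_link j : {set G} := [set v r (beta j); rep j].

(** Owner of the edges between groups g and h with at most one end a terminal.
    Those at the root serve the path from v r (beta j) into group j, and those
    between j and its parent are lent to that same path for its detour. *)
Definition group_owner g h : {set G} :=
  if g == h then set0 else if g == r then root_link h
  else if h == r then root_link g else if child g h then root_link g
  else if child h g then root_link h else [set rep g; rep h].

Definition owner (x y : G) : {set G} :=
  if (x \in codom terminal) && (y \in codom terminal) then [set x; y]
  else match grp x, grp y with
       | Some g, Some h => group_owner g h
       | _, _ => set0
       end.

(** The rule is symmetric because two groups cannot be children of each other:
    the parent of a group is doubled by the root. *)
Lemma group_ownerC g h : group_owner g h = group_owner h g.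
Proof.
rewrite /group_owner eq_sym; have [//|gh] := eqVneq h g.
have [gr|gr] := eqVneq g r; have [hr|hr] := eqVneq h r => //.
  by rewrite gr hr eqxx in gh.
have [cgh|_] := boolP (child g h); have [chg|_] := boolP (child h g) => //.
  case/and3P: cgh chg => _ nd /eqP gh' /and3P[_ nd' _].
  by have [_ _] := parent_route gr nd; rewrite gh' (negPf nd').
by rewrite setUC.
Qed.

Lemma ownerC x y : owner x y = owner y x.
Proof.
rewrite /owner andbC setUC; case: ifP => // _.
by case: (grp x) (grp y) => [g|] [h|] //; apply: group_ownerC.
Qed.

Notation Reg := (region terminal owner).

Lemma region_sym W : symmetric (Reg W).
Proof.
move=> x y; rewrite /region /= adj_sym ownerC.
by rewrite [in X in [&& _, _ & X]]andbC.
Qed.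

Lemma region_terminals x y : adj x y -> x \in codom terminal ->
  y \in codom terminal -> Reg [set x; y] x y.
Proof.
by move=> xy xT yT; rewrite /region /= xy /owner xT yT !inE !eqxx !orbT.
Qed.

Lemma rep_terminal j : rep j \in codom terminal.
Proof. by apply/terminalP; left; exists j. Qed.

Lemma root_terminal b : v r b \in codom terminal.
Proof.
by apply/terminalP; case: b; [right | left; exists r; rewrite /rep beta_r].
Qed.

Lemma terminal_grp x g : x \in codom terminal -> grp x = Some g -> g != r ->
  x = rep g.
Proof.
case/terminalP=> [[j ->]|->]; rewrite grp_v => -[<-] //.
by rewrite eqxx.
Qed.

Lemma pair_region j k x y : j != r -> k != r -> j != k ->
    ~~ child j k -> ~~ child k j -> between j k x y ->
  Reg [set rep j; rep k] x y.
Proof.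
move=> jr kr jk cjk ckj.
wlog [xy gx gy] : x y / [/\ adj x y, grp x = Some j & grp y = Some k].
  move=> wl; case/andP=> xy /orP[] /andP[/eqP gx /eqP gy].
    by apply: wl; rewrite // /between /= xy gx gy !eqxx.
  have yx : adj y x by rewrite adj_sym.
  by rewrite region_sym; apply: wl; rewrite // /between /= yx gx gy !eqxx.
move=> _; rewrite /region /= xy /owner gx gy /group_owner.
rewrite (negPf jk) (negPf jr) (negPf kr) (negPf cjk) (negPf ckj).
apply/and4P; split=> //.
- case: ifP => // /andP[xT yT].
  by rewrite (terminal_grp xT gx) ?(terminal_grp yT gy).
- by apply/implyP => /terminal_grp/(_ gx jr) ->; rewrite set21.
- by apply/implyP => /terminal_grp/(_ gy kr) ->; rewrite set22.
Qed.

Lemma root_terminal_grp x j : x \in codom terminal -> grp x = Some r ->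
  x != v r (~~ beta j) -> x = v r (beta j).
Proof.
have eq_root b : v r b != v r (~~ beta j) -> v r b = v r (beta j).
  by rewrite v_inj; case: b (beta j) => [] [].
case/terminalP=> [[k ->]|->]; last by move=> _ /eq_root.
by rewrite grp_v => -[->]; rewrite /rep; apply: eq_root.
Qed.

Lemma root_region j x y : j != r ->
  avoid (between r j) [set v r (~~ beta j)] x y -> Reg (root_link j) x y.
Proof.
move=> jr.
wlog [xy gx gy] : x y / [/\ adj x y, grp x = Some r & grp y = Some j].
  move=> wl; case/and3P=> /andP[xy /orP[] /andP[/eqP gx /eqP gy]] xS yS.
    by apply: wl; rewrite // /avoid /between /= xy gx gy !eqxx xS.
  have yx : adj y x by rewrite adj_sym.
  rewrite region_sym; apply: wl; rewrite // /avoid /between /=.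
  by rewrite yx gx gy !eqxx yS.
case/and3P=> _; rewrite inE => x_root _.
have rj : (r == j) = false by rewrite eq_sym (negPf jr).
rewrite /region /= xy /owner gx gy /group_owner rj eqxx.
apply/and4P; split=> //.
- case: ifP => // /andP[xT yT].
  by rewrite (root_terminal_grp xT gx x_root) (terminal_grp yT gy).
- by apply/implyP => /root_terminal_grp/(_ gx x_root) ->; rewrite set21.
- by apply/implyP => /terminal_grp/(_ gy jr) ->; rewrite set22.
Qed.

(** Edges of the detour avoid both zigzag vertices of the parent group, hence
    its terminal, so they are never edges between two terminals. *)
Lemma child_region j x y : j != r -> ~~ direct j ->
    avoid (between j (parent j)) (both (parent j)) x y ->
  Reg (root_link j) x y.
Proof.
move=> jr nd; have [fr fj dfj _ _] := parent_route jr nd.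
wlog [xy gx gy] : x y / [/\ adj x y, grp x = Some j & grp y = Some (parent j)].
  move=> wl; case/and3P=> /andP[xy /orP[] /andP[/eqP gx /eqP gy]] xS yS.
    by apply: wl; rewrite // /avoid /between /= xy gx gy !eqxx xS.
  have yx : adj y x by rewrite adj_sym.
  rewrite region_sym; apply: wl; rewrite // /avoid /between /=.
  by rewrite yx gx gy !eqxx yS.
case/and3P=> _ _ yS.
have yT : y \notin codom terminal.
  apply: contraNN yS => /terminal_grp/(_ gy fr) ->.
  by rewrite /rep !inE !v_inj; case: (beta _).
rewrite /region /= xy /owner (negPf yT) andbF gx gy /group_owner.
have jf : (j == parent j) = false by rewrite eq_sym (negPf fj).
rewrite jf (negPf jr) (negPf fr) /child jr nd !eqxx /= andbT.
by apply/implyP => /terminal_grp/(_ gx jr) ->; rewrite set22.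
Qed.

(** Whatever the rule that applies, an edge between groups owned by a pair
    containing the terminal of j has exactly one end in group j. *)
Lemma group_owner_end j g h : j != r -> rep j \in group_owner g h ->
  (g == j) != (h == j).
Proof.
move=> jr; have in_link k : rep j \in root_link k -> k = j.
  case/set2P=> [/(congr1 grp)|/(congr1 grp)]; rewrite !grp_v => -[] // /eqP.
  by rewrite (negPf jr).
have rj : (r == j) = false by rewrite eq_sym (negPf jr).
rewrite /group_owner; have [_|gh] := eqVneq g h; first by rewrite inE.
have [->|gr] := eqVneq g r.
  by move/in_link=> ->; rewrite eqxx rj.
have [->|hr] := eqVneq h r.
  by move/in_link=> ->; rewrite eqxx rj.
have hg : (h == g) = false by rewrite eq_sym (negPf gh).
case: ifP => _; first by move/in_link=> <-; rewrite eqxx hg.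
case: ifP => _; first by move/in_link=> <-; rewrite eqxx (negPf gh).
case/set2P=> /(congr1 grp); rewrite !grp_v => -[->].
  by rewrite eqxx hg.
by rewrite eqxx (negPf gh).
Qed.

(** Bipartiteness of the region of a pair that contains a terminal outside the
    root group: group j is one side. For a path that uses a detour this covers
    edges from group j to two different groups. *)
Lemma region_side j z x y : j != r -> grp z != Some j ->
  Reg [set rep j; z] x y -> (grp x == Some j) != (grp y == Some j).
Proof.
move=> jr zj /and4P[xy /eqP own_xy _ _]; move: own_xy; rewrite /owner.
case: ifP => _.
  have xNy : x != y by apply: contraTneq xy => ->; rewrite adj_irrefl.
  move=> e; have: x \in [set rep j; z] by rewrite -e set21.
  have: y \in [set rep j; z] by rewrite -e set22.
  by do 2!case/set2P=> ?; subst; rewrite ?eqxx // in xNy *;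
    rewrite grp_v eqxx (negPf zj).
have rep_in : rep j \in [set rep j; z] by rewrite set21.
case: (grp x) (grp y) => [g|] [h|] e; rewrite -e ?inE // in rep_in.
exact: group_owner_end rep_in.
Qed.

(** The two root terminals own only the edge joining them. *)
Lemma root_pair_side x y :
  Reg [set v r true; v r false] x y -> (x == v r true) != (y == v r true).
Proof.
case/and4P=> xy /eqP + _ _; rewrite /owner; case: ifP => _.
  have xNy : x != y by apply: contraTneq xy => ->; rewrite adj_irrefl.
  move=> e; have: x \in [set v r true; v r false] by rewrite -e set21.
  have: y \in [set v r true; v r false] by rewrite -e set22.
  by do 2!case/set2P=> ?; subst; rewrite ?eqxx // in xNy *; rewrite v_inj.
have no_link j : j != r -> rep j \notin [set v r true; v r false].
  by move=> jr; rewrite !inE !(negPf (v_neq _ _ jr)).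
case: (grp x) (grp y) => [g|] [h|] /=.
2-4: by move/esym/setP/(_ (v r true)); rewrite !inE eqxx.
rewrite /group_owner; have [_|gh] := eqVneq g h.
  by move/esym/setP/(_ (v r true)); rewrite !inE eqxx.
have [gr|gr] := eqVneq g r.
  have hr : h != r by rewrite -gr eq_sym.
  by move=> e; case/negP: (no_link h hr); rewrite -e set22.
have [hr|hr] := eqVneq h r.
  by move=> e; case/negP: (no_link g gr); rewrite -e set22.
case: ifP => _; first by move=> e;
  case/negP: (no_link g gr); rewrite -e set22.
by case: ifP => _ e; case/negP: (no_link h hr); rewrite -e set22.
Qed.

(** Symmetric form of the condition of [immersion_of_regions], so that one order
    of each kind of pair suffices. *)
Definition linked p q :=
  connect (Reg [set p; q]) p q /\
  exists2 side : G -> bool,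
    forall x y, Reg [set p; q] x y -> side x != side y & side p != side q.

Lemma linkedC p q : linked p q -> linked q p.
Proof.
rewrite /linked setUC => -[c [side flip pq]]; split.
  by rewrite sym_connect_sym //; apply: region_sym.
by exists side; rewrite // eq_sym.
Qed.

Lemma linked_root j b : j != r -> linked (v r b) (rep j).
Proof.
move=> jr; split; last first.
  exists (fun x => grp x == Some j); last first.
    by rewrite !grp_v eqxx (inj_eq Some_inj) (eq_sym r) (negPf jr).
  move=> x y; rewrite setUC; apply: region_side => //.
  by rewrite grp_v (inj_eq Some_inj) eq_sym.
(* One root terminal is adjacent to the terminal of j. The other one uses the
   path by which r doubles j, or else an edge and then the detour of j. *)
have [bj|bj] := eqVneq b (beta j); last first.
  apply/connect1/region_terminals; rewrite ?rep_terminal ?root_terminal //.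
  have -> : b = ~~ beta j by case: b (beta j) bj => [] [].
  by rewrite adj_sym adj_v.
rewrite bj; have [dj|nd] := boolP (direct j).
  apply: (connect_sub _ (direct_route jr dj)) => x y /(root_region jr).
  exact: connect1.
have [fr fj dfj bf c] := parent_route jr nd.
apply: (@connect_trans _ _ (v j (~~ beta j))).
  apply/connect1/root_region => //; rewrite /avoid /= between_v !inE v_inj.
  rewrite (negPf (v_neq _ _ jr)) andbT.
  by case: (beta j).
by apply: (connect_sub _ c) => x y /(child_region jr nd); exact: connect1.
Qed.

Lemma linked_root_pair : linked (v r true) (v r false).
Proof.
split.
  apply/connect1/region_terminals; try exact: root_terminal.
  exact: (adj_v r r true).
by exists (fun x => x == v r true); [exact: root_pair_side | rewrite !v_inj].
Qed.

Hypothesis connect_between : forall i j b b', i != j ->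
  connect (between i j) (v i b) (v j b').

Lemma linked_rep j k : j != r -> k != r -> j != k -> linked (rep j) (rep k).
Proof.
move=> jr kr jk; split; last first.
  exists (fun x => grp x == Some j); last first.
    by rewrite !grp_v eqxx (inj_eq Some_inj) (eq_sym k) (negPf jk).
  by move=> x y; apply: region_side; rewrite // grp_v (inj_eq Some_inj) eq_sym.
(* The edges between a group and its parent are lent to the detour; the two
   terminals do not need them, being adjacent. *)
have adj_child i l : child i l -> adj (rep i) (rep l).
  case/and3P=> ir nd /eqP <-; have [_ _ _ b _] := parent_route ir nd.
  by rewrite /rep b adj_sym adj_v.
have [cjk|cjk] := boolP (child j k).
  by apply/connect1/region_terminals; rewrite ?rep_terminal ?adj_child.
have [ckj|ckj] := boolP (child k j).
  apply/connect1/region_terminals; rewrite ?rep_terminal //.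
  by rewrite adj_sym adj_child.
apply: (connect_sub _ (connect_between (beta j) (beta k) jk)) => x y.
by move/(pair_region jr kr jk cjk ckj); exact: connect1.
Qed.

Lemma immersion_from_routes : has_totally_odd_immersion G (complete s.+1).
Proof.
apply: (immersion_of_regions terminal_inj ownerC) => u u' uu'.
suff: linked (terminal u) (terminal u') by [].
have rep_r : rep r = v r false by rewrite /rep beta_r.
have root_to_rep j : linked (v r true) (rep j).
  have [->|jr] := eqVneq j r; last exact: linked_root.
  by rewrite rep_r; apply: linked_root_pair.
move: uu'; rewrite /terminal.
case: unliftP => [j|] ->; case: unliftP => [k|] ->; rewrite ?eqxx //.
- rewrite (inj_eq lift_inj) => jk.
  have [jr|jr] := eqVneq j r.
    rewrite -/(rep j) jr rep_r; apply: linked_root; by rewrite -jr eq_sym.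
  have [kr|kr] := eqVneq k r; last exact: linked_rep.
  by apply: linkedC; rewrite -/(rep k) kr rep_r; apply: linked_root.
- by move=> _; apply: linkedC; apply: root_to_rep.
- by move=> _; apply: root_to_rep.
Qed.

End Assembly.

Lemma immersion_of_zigzag (i0 : 'I_s) :
  (forall i j x y, i != j -> adj x y -> grp x = Some i -> grp y = Some i ->
     connect (between i j) x y) ->
  has_totally_odd_immersion G (complete s.+1).
Proof.
move=> inner.
have [r [parent [direct [beta [br dP parentP]]]]] := rooted_routes inner i0.
by apply: (immersion_from_routes br dP parentP) => i j b b'; apply: connect_v.
Qed.

End Routing.

(** * Colourings with few edges inside groups *)

Section Colourings.
Variables (G : sgraph) (t : nat).

Lemma sorted_ltn_iota (m : seq nat) :
  sorted ltn m -> all (gtn t) m -> t <= size m -> m = iota 0 t.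
Proof.
move=> sm /allP m_lt le_t.
have um : uniq m.
  by apply: sorted_uniq sm => [? ? ? |?]; [exact: ltn_trans | exact: ltnn].
have sub : {subset m <= iota 0 t} by move=> k /m_lt; rewrite mem_iota.
have [|_ eqm] := uniq_min_size um sub; first by rewrite size_iota.
exact: (irr_sorted_eq ltn_trans ltnn sm (iota_ltn_sorted 0 t) eqm).
Qed.

(** A zigzag of size at least t in a colouring with t colours must use every
    colour exactly once, in increasing order. *)
Lemma rainbow_zigzag (c : G -> 'I_t) : proper_colouring c -> zig G = t ->
  exists z : 'I_t -> G, (forall k, c (z k) = k) /\
    (forall k l : 'I_t, odd k -> ~~ odd l -> adj (z k) (z l)).
Proof.
move=> pc zt; pose c1 x := (val (c x)).+1.
have pc1 : pos_proper_colouring c1.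
  apply/andP; split; first exact/forallP.
  by apply/'forall_forallP=> x y; apply: forallP (forallP pc x) y.
have t_le : t <= zig_col c1.
  rewrite -{1}zt /zig; case: ex_minnP => m _; apply.
  by apply/asboolP; exists c1.
move: t_le; rewrite /zig_col; case: ex_maxnP => k.
case/existsP=> z /andP[zs /forallP zadj] _ t_le.
have map_z : [seq val (c x) | x <- z] = iota 0 t.
  apply: sorted_ltn_iota; rewrite ?size_map ?size_tuple //.
    by rewrite sorted_map; apply: sub_sorted zs => x y.
  by apply/allP=> _ /mapP[x _ ->] /=.
have kt : k = t.
  by rewrite -(size_tuple z) -(size_map (val \o c)) map_z size_iota.
subst k; exists (tnth z); split=> [k|k l ok el].
  apply: val_inj; rewrite (tnth_nth (tnth z k)).
  transitivity (nth 0 [seq val (c x) | x <- z] k).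
    by rewrite (nth_map (tnth z k)) ?size_tuple.
  by rewrite map_z nth_iota.
by have /forallP/(_ l) := zadj k; rewrite ok el.
Qed.

(** A group is a full pair of colours below t; for odd t the top colour is left
    out of all groups. *)
Lemma colour_bound (b : bool) i : i < t./2 -> b + i.*2 < t.
Proof.
move=> it; rewrite -[t]odd_double_half ltn_addl //.
by apply: leq_trans (_ : i.+1.*2 <= _); rewrite ?leq_double // doubleS; case: b.
Qed.

Definition inner_edges (c : {ffun G -> 'I_t}) : {set G * G} :=
  [set a | adj a.1 a.2 && ((c a.1)./2 == (c a.2)./2)].

Definition swap_pairs (i j k : nat) : nat :=
  if k./2 == i then odd k + j.*2 else if k./2 == j then odd k + i.*2 else k.

Lemma half_swap i j k : (swap_pairs i j k)./2 =
  if k./2 == i then j else if k./2 == j then i else k./2.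
Proof.
by rewrite /swap_pairs; do 2?case: ifP => _; rewrite ?half_bit_double.
Qed.

Lemma odd_swap i j k : odd (swap_pairs i j k) = odd k.
Proof.
rewrite /swap_pairs; do 2?case: ifP => _ //.
all: by rewrite oddD odd_double addbF oddb.
Qed.

(** Swapping acts on the groups as a transposition. *)
Lemma half_swap_eq i j k l :
  ((swap_pairs i j k)./2 == (swap_pairs i j l)./2) = (k./2 == l./2).
Proof.
rewrite !half_swap; move: k./2 l./2 => a b; apply/eqP/eqP=> [|-> //].
by case: (a =P i); case: (a =P j); case: (b =P i); case: (b =P j); congruence.
Qed.

Lemma swap_inj i j : injective (swap_pairs i j).
Proof.
move=> k l e; rewrite -[k]odd_double_half -[l]odd_double_half.
have /eqP -> : k./2 == l./2 by rewrite -(half_swap_eq i j) e.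
by rewrite -(odd_swap i j k) e odd_swap.
Qed.

Lemma swap_bound i j k : i < t./2 -> j < t./2 -> k < t -> swap_pairs i j k < t.
Proof.
by move=> it jt kt; rewrite /swap_pairs; do 2?case: ifP; rewrite ?colour_bound.
Qed.

Definition colour_group (c : {ffun G -> 'I_t}) (x : G) : option 'I_(t./2) :=
  insub (c x)./2.

Lemma colour_groupP c x i : colour_group c x = Some i <-> (c x)./2 = i.
Proof.
rewrite /colour_group; split; last by move=> e; rewrite e valK.
by case: insubP => // u _ <- [->].
Qed.

(** Otherwise swap the groups i and j on the component C of x in the bipartite
    graph between them. An edge leaving C inside a group has its ends in
    different groups afterwards, and any other edge leaving C leads outside both
    groups; so the colouring stays proper, and the edge from x to y loses its place
    among the inner edges while no edge joins them. *)
Lemma connect_inner_edge (c : {ffun G -> 'I_t}) i j x y :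
    proper_colouring c ->
    (forall c' : {ffun G -> 'I_t}, proper_colouring c' ->
       #|inner_edges c| <= #|inner_edges c'|) ->
    i != j -> adj x y -> colour_group c x = Some i ->
    colour_group c y = Some i ->
  connect (between (colour_group c) i j) x y.
Proof.
move=> pc c_min ij xy gx gy; apply: contraT => not_xy.
set e := between _ i j in not_xy *; pose C := [set z | connect e x z].
pose c' : {ffun G -> 'I_t} :=
  [ffun z => if z \in C then insubd (c z) (swap_pairs i j (c z)) else c z].
have c'E z : val (c' z) = if z \in C then swap_pairs i j (c z) else c z.
  rewrite ffunE; case: ifP => // _.
  by rewrite insubdK // -topredE /= swap_bound.
have C_grp z : z \in C -> (c z)./2 = i \/ (c z)./2 = j.
  rewrite inE => /connectP[p ep ->]; case/lastP: p ep => [_|p w].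
    by left; apply/colour_groupP.
  rewrite rcons_path last_rcons => /andP[_ /andP[_]].
  case/orP=> /andP[_ /eqP/colour_groupP].
    by right.
  by left.
(* An edge from C whose far end lies in the new group of z would be an edge
   between groups i and j, and its far end would be in C. *)
have boundary z w : adj z w -> z \in C -> w \notin C -> (c' z)./2 != (c' w)./2.
  move=> zw zC wC; rewrite !c'E zC (negPf wC); apply: contraNneq wC.
  rewrite half_swap => g_zw; have: connect e x z by rewrite inE in zC.
  rewrite inE => /connect_trans; apply; apply: connect1.
  rewrite /e /between /= zw /=.
  case: (C_grp _ zC) g_zw => gz; rewrite gz ?eqxx.
    move=> gw; apply/orP; left.
    move/colour_groupP: gz => ->; move/esym/colour_groupP: gw => ->.
    by rewrite !eqxx.
  case: ifP => [/eqP/val_inj ji|_]; first by rewrite ji eqxx in ij.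
  move=> gw; apply/orP; right.
  move/colour_groupP: gz => ->; move/esym/colour_groupP: gw => ->.
  by rewrite !eqxx.
have in_out z w : adj z w -> (z \in C) != (w \in C) -> (c' z)./2 != (c' w)./2.
  case: (boolP (z \in C)) (boolP (w \in C)) => zC [] wC //= zw _.
    exact: boundary.
  by rewrite eq_sym boundary // adj_sym.
have pc' : proper_colouring c'.
  apply/'forall_forallP=> z w; apply/implyP=> zw.
  have := forallP (forallP pc z) w; rewrite zw /= => c_zw.
  have [zwC|] := eqVneq (z \in C) (w \in C); last first.
    by move/(in_out _ _ zw); apply: contraNneq => ->.
  rewrite -val_eqE !c'E -zwC; case: ifP => // _.
  by rewrite (inj_eq (@swap_inj i j)) val_eqE.
suff /proper_card : inner_edges c' \proper inner_edges c.
  by rewrite ltnNge c_min.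
apply/properP; split.
  apply/subsetP=> -[z w]; rewrite !inE /= => /andP[zw]; rewrite zw /=.
  have [zwC|/(in_out _ _ zw)/negPf -> //] := eqVneq (z \in C) (w \in C).
  by rewrite !c'E -zwC; case: ifP => // _; rewrite half_swap_eq.
exists (x, y); rewrite inE /= xy /=.
  by move/colour_groupP: gx => ->; move/colour_groupP: gy => ->.
have xC : x \in C by rewrite inE connect0.
by rewrite in_out // xC inE (negPf not_xy).
Qed.

End Colourings.

Theorem theorem1p4 (t : nat) (ht : 1 <= t) (G : sgraph)
    (hzig : zig G = t) (hchi : chi G = t) :
  has_totally_odd_immersion G (complete (t./2).+1).
Proof.
have [c0 pc0] : exists c : {ffun G -> 'I_t}, proper_colouring c.
  by move: hchi; rewrite /chi; case: ex_minnP => m /existsP[c ?] _ <-; exists c.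
pose P (c : {ffun G -> 'I_t}) := proper_colouring c.
case: (@arg_minnP _ c0 P (fun c => #|inner_edges c|) pc0) => c pc c_min.
have [z [cz adj_z]] := rainbow_zigzag pc hzig.
have v_bound (i : 'I_(t./2)) (b : bool) : b + i.*2 < t.
  exact: colour_bound.
pose v i b := z (Ordinal (v_bound i b)).
have grp_v i b : colour_group c (v i b) = Some i.
  by apply/colour_groupP; rewrite cz /= half_bit_double.
have adj_v i j b : adj (v i b) (v j (~~ b)).
  wlog b_true : i j b / b.
    by case: b => wl; [exact: wl | rewrite adj_sym; exact: wl].
  by apply: adj_z; rewrite b_true /= oddD odd_double.
(* Without any group, that is for t = 1, a single vertex is the immersion. *)
case: (posnP t./2) => [s0|s_gt0]; last first.
  apply: (immersion_of_zigzag grp_v adj_v (Ordinal s_gt0)) => i j x y.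
  exact: connect_inner_edge.
rewrite s0; pose phi (_ : 'I_1) := z (Ordinal ht).
apply: (@immersion_of_regions _ _ phi (fun _ _ => set0)) => // u v'.
- by rewrite !ord1.
- by rewrite !ord1 eqxx.
Qed.
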